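(* Let $\Omega\subseteq\mathbb{R}^n\times\mathbb{R}$ be a closed epi-Lipschitz set and let $\bar\omega\in\operatorname{bdry}\Omega$ (the topological boundary of $\Omega$). Then the following statements are equivalent. (i) $\Omega$ is Clarke super-regular at $\bar\omega$. (ii) $\Omega$ is subsmooth at $\bar\omega$. (iii) Every locally Lipschitz representation $f$ of $\Omega$ at $\bar\omega$ is approximately convex at $\pi(\bar\omega)$. (iv) Some locally Lipschitz representation $f$ of $\Omega$ at $\bar\omega$ is approximately convex at $\pi(\bar\omega)$.
   Context: $\mathbb{B}_r(x)$ is the closed Euclidean ball of radius $r$ centered at $x$. $\operatorname{epi}f=\{(x,\alpha): f(x)\le\alpha\}$. Normal cones. For a set $\Omega$ in a Euclidean space and $\omega\in\Omega$: - The Fréchet normal cone $\hat N_\Omega(\omega)$ is the set of vectors $w$ such that for every $\varepsilon>0$ there is $\delta>0$ with $\langle w,z-\omega\rangle\le\varepsilon\|z-\omega\|$ for all $z\in\Omega\cap\mathbb{B}_\delta(\omega)$. - The limiting normal cone $N_\Omega(\omega)$ is the set of $w$ for which there exist $\omega_k\to\omega$ with $\omega_k\in\Omega$ and $w_k\in\hat N_\Omega(\omega_k)$ with $w_k\to w$. - The Clarke normal cone is $N^{\mathrm C}_\Omega(\omega)=\operatorname{cl}\operatorname{conv}N_\Omega(\omega)$, and for $r>0$ its $r$-truncation is $N^{r\mathrm C}_\Omega(\omega)=N^{\mathrm C}_\Omega(\omega)\cap\mathbb{B}_r(0)$. Clarke super-regularity. $\Omega$ is Clarke super-regular at $\bar\omega\in\Omega$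 if it is locally closed at $\bar\omega$ and for every $\varepsilon>0$ there exists $\delta>0$ such that for every $\hat\omega\in\Omega\cap\mathbb{B}_\delta(\bar\omega)$ and $\hat\omega^*\in N^{\mathrm C}_\Omega(\hat\omega)$ one has $\langle\hat\omega^*,\omega-\hat\omega\rangle\le\varepsilon\|\hat\omega^*\|\,\|\omega-\hat\omega\|$ for all $\omega\in\Omega\cap\mathbb{B}_\delta(\bar\omega)$. Subsmoothness. A closed set $\Omega$ is subsmooth at $\bar\omega\in\Omega$ if for every $r>0$ and $\varepsilon>0$ there exists $\delta>0$ such that for all $\omega_1,\omega_2\in\mathbb{B}_\delta(\bar\omega)\cap\Omega$, all $\omega_1^*\in N^{r\mathrm C}_\Omega(\omega_1)$ and all $\omega_2^*\in N^{r\mathrm C}_\Omega(\omega_2)$ one has $\langle\omega_1^*-\omega_2^*,\omega_1-\omega_2\rangle\ge-\varepsilon\|\omega_1-\omega_2\|$. Epi-Lipschitz sets. $\Omega$ is epi-Lipschitz at $\bar\omega\in\Omega$ if it can be represented near $\bar\omega$ as the epigraph of a Lipschitz continuous function: there are an orthonormal coordinate system (i.e. a linear isometry $A$ of $\mathbb{R}^n\times\mathbb{R}$, by which points are identified with pairs $(x,t)\in\mathbb{R}^n\times\mathbb{R}$), a function $f$ that is Lipschitz continuous near the $\mathbb{R}^n$-component of $A\bar\omega$, and a neighborhood $W$ of $A\bar\omega$ such that $A(\Omega)\cap W=\operatorname{epi}f\cap W$. Such a function $f$ is called a locally Lipschitz representation of $\Omega$ at $\bar\omega$. $\Omega$ is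 epi-Lipschitz if it is so at each of its points. In the coordinates $(x,t)$ of the representation, $\pi(\omega)=x$ denotes the projection onto $\mathbb{R}^n$ (so $\pi(\bar\omega)$ is the $\mathbb{R}^n$-component of $A\bar\omega$). Approximate convexity. $f$ is approximately convex at $\bar x$ if for every $\varepsilon>0$ there exists $\delta>0$ such that for all $x,y\in\mathbb{B}_\delta(\bar x)$ and all $t\in(0,1)$, $f(tx+(1-t)y)\le tf(x)+(1-t)f(y)+\varepsilon t(1-t)\|x-y\|$. *)

(* Defs.v *)
From HB Require Import structures.
From mathcomp Require Import all_boot all_order all_algebra.
From mathcomp Require Import all_classical all_reals all_analysis.

Set Implicit Arguments.
Unset Strict Implicit.
Unset Printing Implicit Defensive.

Import Order.TTheory GRing.Theory Num.Theory.
Import numFieldNormedType.Exports.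

Local Open Scope classical_set_scope.
Local Open Scope ring_scope.

(* The library norms on ['rV[R]_n] and on products are
   sup norms: they induce the Euclidean topology (so [closed], [closure],
   [interior], [nbhs] and [-->] are used as they are), but every metric notion
   below uses the Euclidean inner product and norm defined here. *)

Section EuclideanStructure.
Variables (R : realType) (n : nat).
Local Notation V := ('rV[R]_n * R^o)%type.

Definition dotv (x y : 'rV[R]_n) : R := \sum_(i < n) x ord0 i * y ord0 i.
Definition enormv (x : 'rV[R]_n) : R := Num.sqrt (dotv x x).
Definition eballv (x : 'rV[R]_n) (r : R) : set 'rV[R]_n :=
  [set y | enormv (y - x) <= r].

Definition dot (u v : V) : R := dotv u.1 v.1 + u.2 * v.2.
Definition enorm (u : V) : R := Num.sqrt (dot u u).
Definition eball (u : V) (r : R) : set V := [set v | enorm (v - u) <= r].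

End EuclideanStructure.

Section NormalCones.
Variables (R : realType) (n : nat).
Local Notation V := ('rV[R]_n * R^o)%type.

Definition frechet_normal_cone (Omega : set V) (omega : V) : set V :=
  [set w | forall eps : R, 0 < eps -> exists2 delta : R, 0 < delta &
    forall z, (Omega `&` eball omega delta) z ->
      dot w (z - omega) <= eps * enorm (z - omega)].

Definition limiting_normal_cone (Omega : set V) (omega : V) : set V :=
  [set w | exists omega_ w_ : nat -> V,
    [/\ omega_ @ \oo --> omega,
        forall k, Omega (omega_ k),
        forall k, frechet_normal_cone Omega (omega_ k) (w_ k)
      & w_ @ \oo --> w]].

Definition convex_hull (A : set V) : set V := smallest (@convex_set R V) A.

Definition clarke_normal_cone (Omega : set V) (omega : V) : set V :=
  closure (convex_hull (limiting_normal_cone Omega omega)).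

Definition truncated_clarke_normal_cone (r : R) (Omega : set V) (omega : V)
    : set V :=
  clarke_normal_cone Omega omega `&` eball 0 r.

End NormalCones.

Section Regularity.
Variables (R : realType) (n : nat).
Local Notation V := ('rV[R]_n * R^o)%type.

Definition locally_closed_at (Omega : set V) (omega : V) : Prop :=
  exists2 r : R, 0 < r & closed (Omega `&` eball omega r).

Definition clarke_super_regular (Omega : set V) (omegabar : V) : Prop :=
  [/\ Omega omegabar, locally_closed_at Omega omegabar &
    forall eps : R, 0 < eps -> exists2 delta : R, 0 < delta &
      forall omegahat nu : V,
        (Omega `&` eball omegabar delta) omegahat ->
        clarke_normal_cone Omega omegahat nu ->
        forall omega, (Omega `&` eball omegabar delta) omega ->
          dot nu (omega - omegahat) <=
            eps * enorm nu * enorm (omega - omegahat)].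

Definition subsmooth (Omega : set V) (omegabar : V) : Prop :=
  [/\ closed Omega, Omega omegabar &
    forall r eps : R, 0 < r -> 0 < eps -> exists2 delta : R, 0 < delta &
      forall omega1 omega2 nu1 nu2 : V,
        (eball omegabar delta `&` Omega) omega1 ->
        (eball omegabar delta `&` Omega) omega2 ->
        truncated_clarke_normal_cone r Omega omega1 nu1 ->
        truncated_clarke_normal_cone r Omega omega2 nu2 ->
        dot (nu1 - nu2) (omega1 - omega2) >= - eps * enorm (omega1 - omega2)].

End Regularity.

Section EpiLipschitz.
Variables (R : realType) (n : nat).
Local Notation V := ('rV[R]_n * R^o)%type.

Definition epi (f : 'rV[R]_n -> R) : set V := [set p | f p.1 <= p.2].

Definition lipschitz_near (f : 'rV[R]_n -> R) (xbar : 'rV[R]_n) : Prop :=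
  exists L r : R, 0 < r /\
    forall x y, eballv xbar r x -> eballv xbar r y ->
      `|f x - f y| <= L * enormv (x - y).

Definition isometry (A : V -> V) : Prop := forall v, enorm (A v) = enorm v.

(* The representation consists of both the coordinate system [A] and the
   function [f]; only the values of [f] near [(A omegabar).1] matter. *)
Definition lipschitz_representation (Omega : set V) (omegabar : V)
    (A : {linear V -> V}) (f : 'rV[R]_n -> R) : Prop :=
  [/\ isometry A, lipschitz_near f (A omegabar).1 &
    exists2 W : set V, nbhs (A omegabar) W &
      (A @` Omega) `&` W = epi f `&` W].

Definition epi_lipschitz (Omega : set V) : Prop :=
  forall omega, Omega omega ->
    exists A f, lipschitz_representation Omega omega A f.

Definition approximately_convex (f : 'rV[R]_n -> R) (xbar : 'rV[R]_n) : Prop :=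
  forall eps : R, 0 < eps -> exists2 delta : R, 0 < delta &
    forall x y, eballv xbar delta x -> eballv xbar delta y ->
    forall t : R, 0 < t < 1 ->
      f (t *: x + (1 - t) *: y) <=
        t * f x + (1 - t) * f y + eps * t * (1 - t) * enormv (x - y).

End EpiLipschitz.

(* Main.v *)
Require Import Defs.
From HB Require Import structures.
From mathcomp Require Import all_boot all_order all_algebra.
From mathcomp Require Import all_classical all_reals all_analysis.
From mathcomp Require Import ring lra.

Set Implicit Arguments.
Unset Strict Implicit.
Unset Printing Implicit Defensive.

Import Order.TTheory GRing.Theory Num.Theory.
Import numFieldNormedType.Exports.

Local Open Scope classical_set_scope.
Local Open Scope ring_scope.

(** Everything is read off in the coordinates of a representation, where the
    set is the epigraph of [f].  Coordinates are changed by a linear isometry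
    [A], which is a bijection preserving inner products, so that it transports
    Fréchet normals to Fréchet normals.

    Super-regularity implies subsmoothness by adding two of its inequalities,
    with the roles of the two points exchanged.

    Suppose that [f] is approximately convex, and let [w1], [w2] be two points
    of the epigraph.  The segment from [w1] to [w2], tilted upwards by an
    arbitrarily small slope, stays in the epigraph, so its direction makes an
    obtuse angle with every Fréchet normal at [w1]
    ([approximately_convex_frechet]).  Since the tilt is a multiple of the
    vertical direction, this inequality is linear in the normal and continuous
    in the base point: it therefore passes to limiting normals, and from there
    to their closed convex hull ([clarke_normal_le]).  This is
    super-regularity.

    Conversely, let the set be subsmooth.  Each proximal subgradient [g] of [f]
    at [p] gives the normal [(g, -1)] at [(p, f p)] ([proximal_frechet]), and a
    boundary point lies on the graph ([boundary_on_graph]), so subsmoothness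
    says that the proximal subgradients are submonotone up to a small error.
    There are enough of these subgradients to control [f]: an approximate mean
    value inequality ([approximate_mean_value]), obtained by minimising a
    penalised function over a compact set, finds one near any segment [a, b]
    whose slope along [b - a] is almost [f b - f a] or more.  If [f] bulged at
    an intermediate point [z] of [x, y], applying it on [x, z] and on [y, z]
    would produce two subgradients violating submonotonicity
    ([submonotone_approximately_convex]). *)

(** * Inner products *)

Section InnerProduct.
Variables (R : realType) (V : lmodType R).

Definition inner_product (ip : V -> V -> R) : Prop :=
  [/\ forall x y, ip x y = ip y x,
      forall x y z, ip (x + y) z = ip x z + ip y z,
      forall a x y, ip (a *: x) y = a * ip x y
    & forall x, 0 <= ip x x].

Variables (ip : V -> V -> R) (hip : inner_product ip).

Lemma ipC x y : ip x y = ip y x. Proof. by case: hip. Qed.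
Lemma ipDl x y z : ip (x + y) z = ip x z + ip y z. Proof. by case: hip. Qed.
Lemma ipZl a x y : ip (a *: x) y = a * ip x y. Proof. by case: hip. Qed.
Lemma ip_ge0 x : 0 <= ip x x. Proof. by case: hip. Qed.
Lemma ipDr x y z : ip z (x + y) = ip z x + ip z y.
Proof. by rewrite ipC ipDl !(ipC z). Qed.
Lemma ipZr a x y : ip y (a *: x) = a * ip y x.
Proof. by rewrite ipC ipZl ipC. Qed.
Lemma ipNl x y : ip (- x) y = - ip x y.
Proof. by rewrite -scaleN1r ipZl mulN1r. Qed.
Lemma ipNr x y : ip x (- y) = - ip x y.
Proof. by rewrite ipC ipNl ipC. Qed.

Lemma ip_sqr_sqrt x : Num.sqrt (ip x x) ^+ 2 = ip x x.
Proof. by rewrite sqr_sqrtr ?ip_ge0. Qed.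

Lemma ip_le_sqrt x y : ip x y <= Num.sqrt (ip x x) * Num.sqrt (ip y y).
Proof.
rewrite -sqrtrM ?ip_ge0//; case: (lerP (ip x y) 0) => [h|h].
  exact: le_trans (sqrtr_ge0 _).
have -> : ip x y = Num.sqrt (ip x y ^+ 2) by rewrite sqrtr_sqr ger0_norm ?ltW.
rewrite ler_sqrt ?mulr_ge0 ?ip_ge0 //.
have quad s t : 0 <= s * s * ip x x - 2 * s * t * ip x y + t * t * ip y y.
  have := ip_ge0 (s *: x + (- t) *: y).
  by rewrite !ipDl !ipDr !ipZl !ipZr (ipC y x); lra.
have := ip_ge0 x; have := ip_ge0 y; rewrite expr2.
rewrite le0r => /orP[/eqP yy0 _|yy0 xx0].
  (* The discriminant argument degenerates: a nonzero [ip x y] would make the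
     quadratic form negative at this point. *)
  have := quad (ip x y) ((ip x x + 1) / 2).
  rewrite yy0 !mulr0 !addr0.
  have b2 : 0 < ip x y * ip x y by rewrite -expr2 exprn_gt0.
  by nra.
have := quad (ip y y) (ip x y); nra.
Qed.

Lemma ip_sqrtD x y :
  Num.sqrt (ip (x + y) (x + y)) <= Num.sqrt (ip x x) + Num.sqrt (ip y y).
Proof.
rewrite -(@ler_pXn2r _ 2) ?nnegrE ?addr_ge0 ?sqrtr_ge0 //.
rewrite ip_sqr_sqrt sqrrD !ip_sqr_sqrt ipDl !ipDr (ipC y x).
by have := ip_le_sqrt x y; lra.
Qed.

Lemma ip_sqrtZ a x : Num.sqrt (ip (a *: x) (a *: x)) = `|a| * Num.sqrt (ip x x).
Proof.
by rewrite ipZl ipZr mulrA -expr2 sqrtrM ?sqr_ge0// sqrtr_sqr.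
Qed.

Lemma ip_sqrtN x : Num.sqrt (ip (- x) (- x)) = Num.sqrt (ip x x).
Proof. by rewrite ipNl ipNr opprK. Qed.

End InnerProduct.

Section Euclidean.
Variables (R : realType) (n : nat).
Local Notation V := ('rV[R]_n * R^o)%type.
Implicit Types (x y z : 'rV[R]_n) (u v w : V) (a r : R).

Lemma dotv_inner_product : inner_product (@dotv R n).
Proof.
split=> [x y|x y z|a x y|x]; rewrite /dotv.
- by apply: eq_bigr => i _; rewrite mulrC.
- by rewrite -big_split; apply: eq_bigr => i _; rewrite mxE mulrDl.
- by rewrite mulr_sumr; apply: eq_bigr => i _; rewrite mxE mulrA.
- by apply: sumr_ge0 => i _; rewrite -expr2 sqr_ge0.
Qed.

Lemma dot_inner_product : inner_product (@dot R n).
Proof.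
have [C D Z ge0] := dotv_inner_product.
split=> [x y|x y z|a x y|x]; rewrite /dot.
- by rewrite C mulrC.
- by rewrite D mulrDl addrACA.
- by rewrite Z mulrDr mulrA.
- by rewrite addr_ge0// -expr2 sqr_ge0.
Qed.

Lemma enormv_ge0 x : 0 <= enormv x. Proof. exact: sqrtr_ge0. Qed.
Lemma enormvD x y : enormv (x + y) <= enormv x + enormv y.
Proof. exact: ip_sqrtD dotv_inner_product _ _. Qed.
Lemma enormvZ a x : enormv (a *: x) = `|a| * enormv x.
Proof. exact: ip_sqrtZ dotv_inner_product _ _. Qed.
Lemma enormvN x : enormv (- x) = enormv x.
Proof. exact: ip_sqrtN dotv_inner_product _. Qed.
Lemma enormvB x y : enormv (x - y) = enormv (y - x).
Proof. by rewrite -enormvN opprB. Qed.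
Lemma enormv0 : enormv (0 : 'rV[R]_n) = 0.
Proof. by rewrite -(scale0r (0 : 'rV[R]_n)) enormvZ normr0 mul0r. Qed.
Lemma enormv_sqr x : enormv x ^+ 2 = dotv x x.
Proof. exact: ip_sqr_sqrt dotv_inner_product _. Qed.
Lemma enormv_sqrD x y :
  enormv (x + y) ^+ 2 = enormv x ^+ 2 + 2 * dotv x y + enormv y ^+ 2.
Proof.
have ip := dotv_inner_product; rewrite !enormv_sqr (ipDl ip) !(ipDr ip).
by rewrite (ipC ip y x); lra.
Qed.
Lemma dotv_le x y : dotv x y <= enormv x * enormv y.
Proof. exact: ip_le_sqrt dotv_inner_product _ _. Qed.
Lemma enormv_triangle z x y : enormv (x - y) <= enormv (x - z) + enormv (z - y).
Proof. by apply: le_trans (enormvD _ _); rewrite addrA subrK. Qed.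

Lemma enorm_ge0 u : 0 <= enorm u. Proof. exact: sqrtr_ge0. Qed.
Lemma enormD u v : enorm (u + v) <= enorm u + enorm v.
Proof. exact: ip_sqrtD dot_inner_product _ _. Qed.
Lemma enormZ a u : enorm (a *: u) = `|a| * enorm u.
Proof. exact: ip_sqrtZ dot_inner_product _ _. Qed.
Lemma enormN u : enorm (- u) = enorm u.
Proof. exact: ip_sqrtN dot_inner_product _. Qed.
Lemma enorm0 : enorm (0 : V) = 0.
Proof. by rewrite -(scale0r (0 : V)) enormZ normr0 mul0r. Qed.
Lemma enorm_sqr u : enorm u ^+ 2 = dot u u.
Proof. exact: ip_sqr_sqrt dot_inner_product _. Qed.
Lemma dot_le u v : dot u v <= enorm u * enorm v.
Proof. exact: ip_le_sqrt dot_inner_product _ _. Qed.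
Lemma enorm_triangle w u v : enorm (u - v) <= enorm (u - w) + enorm (w - v).
Proof. by apply: le_trans (enormD _ _); rewrite addrA subrK. Qed.

Lemma enorm_le_add u : enorm u <= enormv u.1 + `|u.2|.
Proof.
rewrite -(@ler_pXn2r _ 2) ?nnegrE ?addr_ge0 ?sqrtr_ge0 //.
rewrite enorm_sqr sqrrD enormv_sqr real_normK ?num_real// /dot expr2.
by have := mulr_ge0 (enormv_ge0 u.1) (normr_ge0 u.2); lra.
Qed.

Lemma enormv_le_enorm u : enormv u.1 <= enorm u.
Proof.
rewrite ler_sqrt ?lerDl -?expr2 ?sqr_ge0// ip_ge0//.
exact: dot_inner_product.
Qed.

Lemma norm_le_enorm u : `|u.2| <= enorm u.
Proof.
rewrite -sqrtr_sqr ler_sqrt ?ip_ge0//; last exact: dot_inner_product.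
by rewrite /dot -expr2 lerDr ip_ge0//; exact: dotv_inner_product.
Qed.

Lemma coord_le_enormv x i : `|x ord0 i| <= enormv x.
Proof.
rewrite -sqrtr_sqr ler_sqrt ?ip_ge0//; last exact: dotv_inner_product.
rewrite /dotv (bigD1 i)//= -expr2 lerDl; apply: sumr_ge0 => j _.
by rewrite -expr2 sqr_ge0.
Qed.

Lemma mx_norm_le_enormv x : `|x| <= enormv x.
Proof.
rewrite [leLHS]/Num.norm /= mx_normrE; apply/bigmax_leP.
split=> [|[i j] _]; first exact: enormv_ge0.
by rewrite (ord1 i); exact: coord_le_enormv.
Qed.

End Euclidean.
(** * Euclidean balls and the topology *)

Section Topology.
Variables (R : realType) (n : nat).
Local Notation V := ('rV[R]_n * R^o)%type.
Implicit Types (x y z : 'rV[R]_n) (u v w p : V) (a r : R).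

Lemma norm_le_enorm_prod u : `|u| <= enorm u.
Proof.
rewrite prod_normE ge_max norm_le_enorm andbT.
exact: le_trans (mx_norm_le_enormv _) (enormv_le_enorm _).
Qed.

Lemma cvg_dotv (T : Type) (F : set_system T) (FF : Filter F)
    (f g : T -> 'rV[R]_n) x y :
  f @ F --> x -> g @ F --> y -> dotv (f t) (g t) @[t --> F] --> dotv x y.
Proof.
move=> fx gy; rewrite /dotv.
apply: (@cvg_big _ _ +%R 0 xpredT) => [z|i _]; first exact: add_continuous.
by apply: cvgM; [exact: (cvg_comp _ _ fx (@coord_continuous _ _ _ ord0 i x))
                |exact: (cvg_comp _ _ gy (@coord_continuous _ _ _ ord0 i y))].
Qed.

Lemma cvg_dot (T : Type) (F : set_system T) (FF : Filter F) (f g : T -> V) u v :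
  f @ F --> u -> g @ F --> v -> dot (f t) (g t) @[t --> F] --> dot u v.
Proof.
move=> fu gv; rewrite /dot.
have h1 (h : T -> V) w : h @ F --> w -> (h t).1 @[t --> F] --> w.1.
  by move=> hw; apply: cvg_comp hw _; exact: cvg_fst.
have h2 (h : T -> V) w : h @ F --> w -> (h t).2 @[t --> F] --> w.2.
  by move=> hw; apply: cvg_comp hw _; exact: cvg_snd.
by apply: cvgD; [apply: cvg_dotv; exact: h1|apply: cvgM; exact: h2].
Qed.

Lemma cvg_enorm (T : Type) (F : set_system T) (FF : Filter F) (f : T -> V) u :
  f @ F --> u -> enorm (f t) @[t --> F] --> enorm u.
Proof.
by move=> fu; exact: (cvg_comp _ _ (cvg_dot FF fu fu) (@sqrt_continuous R _)).
Qed.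

Lemma cvg_enormv (T : Type) (F : set_system T) (FF : Filter F)
    (f : T -> 'rV[R]_n) x :
  f @ F --> x -> enormv (f t) @[t --> F] --> enormv x.
Proof.
by move=> fu; exact: (cvg_comp _ _ (cvg_dotv FF fu fu) (@sqrt_continuous R _)).
Qed.

Lemma nbhs_eball u r : 0 < r -> nbhs u (eball u r).
Proof.
move=> r0; have /cvgr_le : enorm (v - u) @[v --> u] --> enorm (u - u).
  by apply: cvg_enorm; apply: cvgB; [exact: cvg_id|exact: cvg_cst].
by rewrite subrr enorm0 => /(_ _ r0).
Qed.

Lemma cvg_enormvB x y : enormv (z - x) @[z --> y] --> enormv (y - x).
Proof.
have h : (fun z : 'rV[R]_n => z - x) @ y --> y - x.
  exact: (cvgB cvg_id (cvg_cst _)).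
exact: (cvg_enormv _ h).
Qed.

Lemma nbhs_eball_sub u (W : set V) :
  nbhs u W -> exists2 r : R, 0 < r & eball u r `<=` W.
Proof.
move=> /nbhs_normP[e /= e0 eW]; exists (e / 2); first by rewrite divr_gt0.
move=> v uv; apply: eW => /=; rewrite distrC.
apply: le_lt_trans (norm_le_enorm_prod _) _.
by apply: le_lt_trans uv _; lra.
Qed.

Lemma closed_eball u r : closed (eball u r).
Proof.
have c : continuous (fun v : V => enorm (v - u)).
  by move=> v; apply: cvg_enorm; apply: cvgB; [exact: cvg_id|exact: cvg_cst].
exact: (preimage_closed (fun v _ => c v) (@closed_le R r)).
Qed.

Lemma compact_eballv x r : compact (eballv x r).
Proof.
apply: bounded_closed_compact.
  exists (enormv x + r); split; first exact: num_real.
  move=> M hM y yx; apply: le_trans (mx_norm_le_enormv _) _.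
  apply: le_trans (_ : _ <= enormv (y - x) + enormv x) _.
    by rewrite -[leLHS](congr1 (@enormv R n) (subrK x y)) enormvD.
  by apply: ltW; apply: le_lt_trans hM; rewrite addrC lerD2l.
have c : continuous (fun y => enormv (y - x)).
  by move=> y; exact: cvg_enormvB.
exact: (preimage_closed (fun y _ => c y) (@closed_le R r)).
Qed.

End Topology.
(** * Normal cones *)

Section Cones.
Variables (R : realType) (n : nat).
Local Notation V := ('rV[R]_n * R^o)%type.
Implicit Types (Omega : set V) (u v w p omega nu h : V).

(** A direction along which one can leave [omega] while staying in [Omega] is
    tangent to [Omega]; dividing the defining inequality of the Fréchet normal
    cone by the length of the step, which tends to 0, gives the sign. *)
Lemma frechet_normal_feasible Omega omega nu h (s0 : R) :
  frechet_normal_cone Omega omega nu -> 0 < s0 ->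
  (forall s, 0 < s <= s0 -> Omega (omega + s *: h)) -> dot nu h <= 0.
Proof.
move=> hnu s00 hs; rewrite leNgt; apply/negP => nuh.
have h1 : 0 < enorm h + 1 by have := enorm_ge0 h; lra.
have [|d d0 hd] := hnu (dot nu h / (2 * (enorm h + 1))).
  by rewrite divr_gt0// mulr_gt0.
pose s := Num.min s0 (d / (enorm h + 1)).
have sgt0 : 0 < s by rewrite lt_min s00 divr_gt0.
have ss0 : s <= s0 by rewrite ge_min lexx.
have sd : s * enorm h <= d.
  have : s * (enorm h + 1) <= d by rewrite -ler_pdivlMr// ge_min lexx orbT.
  by lra.
have es : enorm (s *: h) = s * enorm h by rewrite enormZ gtr0_norm.
have /hd : (Omega `&` eball omega d) (omega + s *: h).
  split; first by apply: hs; rewrite sgt0.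
  by rewrite /eball /= addrC addKr es.
rewrite addrC addKr es (ipZr (dot_inner_product R n)) mulrCA ler_pM2l//.
rewrite mulrC mulrA ler_pdivlMr ?mulr_gt0//.
have := enorm_ge0 h; nra.
Qed.

Lemma frechet_sub_clarke Omega omega : Omega omega ->
  frechet_normal_cone Omega omega `<=` clarke_normal_cone Omega omega.
Proof.
move=> Oo nu hnu; apply: subset_closure; apply: sub_gen_smallest.
exists (fun=> omega), (fun=> nu); split => //; exact: cvg_cst.
Qed.

(** Passing from limiting to Clarke normals preserves any linear inequality,
    because half-spaces are closed and convex. *)
Lemma clarke_normal_le Omega omega h :
  (forall nu, limiting_normal_cone Omega omega nu -> dot nu h <= 0) ->
  forall nu, clarke_normal_cone Omega omega nu -> dot nu h <= 0.
Proof.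
move=> hle; pose H : set V := [set nu | dot nu h <= 0].
have cH : closed H.
  have c : continuous (fun nu : V => dot nu h).
    by move=> w; apply: cvg_dot; [exact: cvg_id|exact: cvg_cst].
  exact: (preimage_closed (fun nu _ => c nu) (@closed_le R 0)).
suff : convex_hull (limiting_normal_cone Omega omega) `<=` H.
  by move/closureS; rewrite -(proj1 (closure_id H) cH).
apply: smallest_sub hle => u v t; rewrite !inE /H /= => uh vh.
have [t0 t1] : 0 <= t%:num /\ t%:num <= 1 by split.
change (dot (t%:num *: u + (1 - t%:num) *: v) h <= 0).
rewrite (ipDl (dot_inner_product R n)) !(ipZl (dot_inner_product R n)).
by nra.
Qed.

End Cones.

(** * Linear isometries *)

Section Isometries.
Variables (R : realType) (n : nat).
Local Notation V := ('rV[R]_n * R^o)%type.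
Variables (A : {linear V -> V}) (hA : Defs.isometry A).
Implicit Types (u v p : V).

Lemma isometry_dot u v : dot (A u) (A v) = dot u v.
Proof.
have e (w z : V) : dot (w + z) (w + z) = dot w w + 2 * dot w z + dot z z.
  rewrite !(ipDl (dot_inner_product R n)) !(ipDr (dot_inner_product R n)).
  by rewrite (ipC (dot_inner_product R n) z w); lra.
have q w : dot (A w) (A w) = dot w w by rewrite -!enorm_sqr hA.
by have := q (u + v); rewrite linearD !e !q; lra.
Qed.

Lemma isometry_inj : injective A.
Proof.
move=> u v Auv; apply/eqP; rewrite -subr_eq0 -normr_le0.
apply: le_trans (norm_le_enorm_prod _) _.
by rewrite -hA linearB Auv subrr enorm0.
Qed.

(** An injective endomorphism of a finite-dimensional space is onto; normals can
    thus be pulled back from the coordinates of a representation. *)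
Lemma isometry_surj p : exists u, A u = p.
Proof.
have /lker0P/lker0_limgf fullA : injective (linfun A).
  by move=> u v; rewrite !lfunE; exact: isometry_inj.
have : p \in limg (linfun A) by rewrite fullA memvf.
by case/memv_imgP => u _ ->; exists u; rewrite lfunE.
Qed.

End Isometries.
(** * Clarke super-regularity *)

Section Regularity.
Variables (R : realType) (n : nat).
Local Notation V := ('rV[R]_n * R^o)%type.
Implicit Types (Omega : set V) (u v w p omega nu h : V) (f : 'rV[R]_n -> R).

(** As [A] is an isometry, the neighbourhood of [A omega] on which the
    representation is valid can be replaced with a ball around [omega]. *)
Lemma representation_near Omega omega (A : {linear V -> V}) f :
  lipschitz_representation Omega omega A f ->
  exists2 r : R, 0 < r & forall v, eball omega r v -> Omega v <-> epi f (A v).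
Proof.
case=> hA _ [W /nbhs_eball_sub[r r0 rW] AW]; exists r => // v hv.
have Wv : W (A v) by apply: rW; rewrite /eball /= -linearB hA.
split => [Ov|ev].
  by have : ((A @` Omega) `&` W) (A v) by []; rewrite AW => -[].
have : (epi f `&` W) (A v) by [].
by rewrite -AW => -[[u Ou /(isometry_inj hA) <-]].
Qed.

(** Super-regularity with bound [eps / (2 * r)], applied to normals of length at
    most [r], contributes [eps / 2] for each of the two points. *)
Lemma super_regular_subsmooth Omega omega :
  closed Omega -> clarke_super_regular Omega omega -> subsmooth Omega omega.
Proof.
move=> cO [Oo _ hsr]; split => // r eps r0 eps0.
have [|d d0 hd] := hsr (eps / (2 * r)); first by rewrite divr_gt0// mulr_gt0.
exists d => // u1 u2 nu1 nu2 [b1 O1] [b2 O2] [N1 r1] [N2 r2].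
have bound u v nu : Omega u -> eball omega d u -> Omega v -> eball omega d v ->
    clarke_normal_cone Omega u nu -> eball 0 r nu ->
    dot nu (v - u) <= eps / 2 * enorm (v - u).
  rewrite {3}/eball /= subr0 => Ou bu Ov bv Nu nur.
  apply: le_trans (hd _ _ (conj Ou bu) Nu _ (conj Ov bv)) _.
  rewrite ler_wpM2r ?enorm_ge0//; apply: le_trans (ler_wpM2l _ nur) _.
    by rewrite divr_ge0 ?ltW// mulr_gt0.
  by rewrite le_eqVlt; apply/orP; left; apply/eqP; field; rewrite gt_eqF.
have ip := dot_inner_product R n.
have := bound _ _ _ O1 b1 O2 b2 N1 r1; have := bound _ _ _ O2 b2 O1 b1 N2 r2.
rewrite -[u2 - u1]opprB enormN (ipNr ip) (ipDl ip) (ipNl ip).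
lra.
Qed.

(** The core of the implication from approximate convexity to super-regularity.
    With [x], [y] the projections of [A omega1], [A omega2], approximate
    convexity says that the segment from [A omega1] to [A omega2], tilted
    upwards by the slope [eps * enormv (y - x)], stays in the epigraph; hence
    this tilted direction is feasible at [omega1].  Writing the tilt as a
    multiple of the vertical vector [e] makes the resulting inequality linear
    in the normal, so that it survives limits and convex combinations. *)
Lemma approximately_convex_frechet Omega omega (A : {linear V -> V}) f e
    (r d eps : R) :
  Defs.isometry A -> A e = (0, 1) -> 0 < eps ->
  (forall v, eball omega r v -> Omega v <-> epi f (A v)) ->
  (forall x y, eballv (A omega).1 d x -> eballv (A omega).1 d y ->
    forall t : R, 0 < t < 1 ->
      f (t *: x + (1 - t) *: y) <=
        t * f x + (1 - t) * f y + eps * t * (1 - t) * enormv (x - y)) ->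
  forall omega1 omega2 nu,
    Omega omega1 -> enorm (omega1 - omega) < r -> enorm (omega1 - omega) < d ->
    Omega omega2 -> enorm (omega2 - omega) < r -> enorm (omega2 - omega) < d ->
    frechet_normal_cone Omega omega1 nu ->
    dot nu e <= 0 /\
    dot nu (omega2 - omega1 + (eps * enorm (omega2 - omega1)) *: e) <= 0.
Proof.
move=> hA Ae eps0 hO hf w1 w2 nu O1 r1 d1 O2 r2 d2 hnu.
have ip := dot_inner_product R n.
have E1 : f (A w1).1 <= (A w1).2 by apply/hO => //; exact: ltW.
have E2 : f (A w2).1 <= (A w2).2 by apply/hO => //; exact: ltW.
(* Points close to [w1] are in the set as soon as their images are in the
   epigraph. *)
have feasible h : (forall t, 0 < t < 1 -> epi f (A (w1 + t *: h))) ->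
    dot nu h <= 0.
  move=> hh; have h1 : 0 < enorm h + 1 by have := enorm_ge0 h; lra.
  pose s0 := Num.min (1 / 2) ((r - enorm (w1 - omega)) / (enorm h + 1)).
  apply: (frechet_normal_feasible (s0 := s0) hnu).
    by rewrite lt_min divr_gt0//= divr_gt0// subr_gt0.
  move=> s /andP[s_gt0]; rewrite le_min (ler_pdivlMr _ _ h1) => /andP[s1 sr].
  apply/hO; last by apply: hh; rewrite s_gt0 /=; lra.
  rewrite /eball /= addrAC; apply: le_trans (enormD _ _) _.
  by rewrite enormZ gtr0_norm//; lra.
have e0 : dot nu e <= 0.
  apply: feasible => t /andP[t0 _].
  by rewrite /epi /= linearD linearZ /= Ae /= scaler0 addr0 scaler1; lra.
split => //.
have nrm1 v : enormv ((A v).1 - (A omega).1) <= enorm (v - omega).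
  by rewrite -hA linearB; exact: enormv_le_enorm (A v - A omega).
pose m := enormv ((A w2).1 - (A w1).1).
have mle : m <= enorm (w2 - w1).
  by rewrite -hA linearB; exact: enormv_le_enorm (A w2 - A w1).
have : dot nu (w2 - w1 + (eps * m) *: e) <= 0.
  apply: feasible => t /andP[t0 t1].
  have := hf _ _ (le_trans (nrm1 _) (ltW d2)) (le_trans (nrm1 _) (ltW d1)) t.
  rewrite t0 t1 => /(_ isT).
  rewrite /epi /=.
  have -> : A (w1 + t *: (w2 - w1 + (eps * m) *: e)) =
            A w1 + t *: (A w2 - A w1 + (eps * m) *: (0, 1)).
    by rewrite linearD linearZ /= linearD linearB linearZ /= Ae.
  rewrite /=.
  rewrite scaler0 addr0 -/m.
  have -> : (A w1).1 + t *: ((A w2).1 - (A w1).1) =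
            t *: (A w2).1 + (1 - t) *: (A w1).1.
    by rewrite scalerBr scalerBl scale1r addrCA.
  move=> hle; apply: le_trans hle _.
  have m0 : 0 <= m by exact: enormv_ge0.
  have tm : 0 <= t * m by rewrite mulr_ge0// ltW.
  rewrite /GRing.scale /=.
  have : 0 <= eps * t * t * m by rewrite !mulr_ge0// ltW.
  nra.
(* Replacing [m] by the larger [enorm (w2 - w1)] is harmless, as
   [dot nu e <= 0]. *)
rewrite !(ipDr ip) !(ipZr ip).
have : 0 <= eps * (enorm (w2 - w1) - m) * - dot nu e.
  by rewrite !mulr_ge0 ?subr_ge0 ?oppr_ge0// ltW.
lra.
Qed.

Lemma approximately_convex_super_regular Omega omega (A : {linear V -> V}) f :
  closed Omega -> Omega omega -> lipschitz_representation Omega omega A f ->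
  approximately_convex f (A omega).1 -> clarke_super_regular Omega omega.
Proof.
move=> cO Oo rep hf; have [r r0 hr] := representation_near rep.
have [hA _ _] := rep; have [e Ae] := isometry_surj hA (0, 1).
have ip := dot_inner_product R n.
have ne : enorm e = 1.
  rewrite -hA Ae /enorm /dot /= -enormv_sqr enormv0 expr0n /=.
  by rewrite add0r mul1r sqrtr1.
split => //.
  by exists 1 => //; apply: closedI => //; exact: closed_eball.
move=> eps eps0; have [d d0 hd] := hf _ eps0.
pose k := Num.min r d / 2.
have rd0 : 0 < Num.min r d by rewrite lt_min r0.
have [rdr rdd] : Num.min r d <= r /\ Num.min r d <= d.
  by rewrite !ge_min !lexx orbT.
have kr : k < r by rewrite /k; lra.
have kd : k < d by rewrite /k; lra.
exists k; first by rewrite divr_gt0.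
move=> w1 nu [w1O k1] hnu w2 [w2O k2].
have hlim nu' : limiting_normal_cone Omega w1 nu' -> dot nu' e <= 0 /\
    dot nu' (w2 - w1 + (eps * enorm (w2 - w1)) *: e) <= 0.
  case=> [u_ [nu_ [uw Ou hnu_ nunu]]].
  have near_u c : k < c -> \forall i \near \oo, enorm (u_ i - omega) < c.
    move=> kc; have : enorm (u_ i - omega) @[i --> \oo] --> enorm (w1 - omega).
      by apply: cvg_enorm; apply: cvgB; [exact: uw|exact: cvg_cst].
    by move/cvgr_lt; apply; apply: le_lt_trans k1 kc.
  have main : \forall i \near \oo, dot (nu_ i) e <= 0 /\
      dot (nu_ i) (w2 - u_ i + (eps * enorm (w2 - u_ i)) *: e) <= 0.
    near=> i; apply: (approximately_convex_frechet hA Ae eps0 hr hd) => //.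
    - by near: i; exact: near_u.
    - by near: i; exact: near_u.
    - exact: le_lt_trans k2 kr.
    - exact: le_lt_trans k2 kd.
  have w2u : w2 - u_ i @[i --> \oo] --> w2 - w1.
    by apply: cvgB; [exact: cvg_cst|exact: uw].
  split.
    apply: (ler_cvg_to (cvg_dot _ nunu (cvg_cst e)) (cvg_cst 0)).
    by apply: filterS main => i [].
  apply: (ler_cvg_to (cvg_dot _ nunu _) (cvg_cst 0)); last first.
    by apply: filterS main => i [_]; exact.
  apply: cvgD => //; apply: cvgZr_tmp.
  apply: cvgMl_tmp; exact: cvg_enorm.
have ele : dot nu e <= 0 by apply: clarke_normal_le hnu => nu' /hlim[].
(* The last coordinate of [A nu] is bounded by the norm of [nu], which brings
   the factor [enorm nu] back. *)
have := clarke_normal_le (fun nu' lnu' => (hlim nu' lnu').2) hnu.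
rewrite (ipDr ip) (ipZr ip) => hle.
have : - dot nu e <= enorm nu.
  by rewrite -(ipNr ip) -[leRHS]mulr1 -ne -(enormN e) dot_le.
have := enorm_ge0 (w2 - w1) => n0 hb.
have : 0 <= eps * enorm (w2 - w1) * (enorm nu + dot nu e).
  by rewrite !mulr_ge0//; [exact: ltW|lra].
lra.
Unshelve. all: by end_near.
Qed.

End Regularity.
(** * Proximal subgradients of Lipschitz functions *)

Section ProximalSubgradients.
Variables (R : realType) (n : nat).
Implicit Types (f : 'rV[R]_n -> R) (a b x y p g : 'rV[R]_n) (L r eta : R).

Definition lipschitz_on_ball f x r L : Prop :=
  forall y z, eballv x r y -> eballv x r z ->
    `|f y - f z| <= L * enormv (y - z).

(** The quadratic lower bound is stronger than what a Fréchet subgradient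
    requires; it is what minimising [f] plus a squared distance yields. *)
Definition proximal_subgradient f p g : Prop :=
  exists K rho : R, [/\ 0 < K, 0 < rho & forall y, enormv (y - p) <= rho ->
    f p + dotv g (y - p) - K * enormv (y - p) ^+ 2 <= f y].

(** [f] is only controlled on a ball, hence the relative continuity that the
    extreme value theorem on compact sets accepts. *)
Lemma lipschitz_within f x r L (T : topologicalType) (S : set T)
    (h : T -> 'rV[R]_n) :
  lipschitz_on_ball f x r L -> continuous h ->
  (forall w, S w -> eballv x r (h w)) ->
  {within S, continuous (f \o h)}.
Proof.
move=> fL ch hS; apply/subspace_continuousP => w Sw /=.
have hL : L * enormv (h w - h v) @[v --> w] --> L * enormv (h w - h w).
  by apply: cvgMl_tmp; exact: (cvg_enormv _ (cvgB (cvg_cst _) (ch w))).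
rewrite subrr enormv0 mulr0 in hL.
apply/cvgrPdist_le => e e0; rewrite near_withinE.
have hn := cvgr_le _ hL _ e0.
near=> v => Sv /=.
have hv : L * enormv (h w - h v) <= e by near: v; exact: hn.
by apply: le_trans hv; apply: fL; exact: hS.
Unshelve. all: by end_near.
Qed.

Lemma eballv_segment x r a b (s : R) : eballv x r a -> eballv x r b ->
  0 <= s <= 1 -> eballv x r (a + s *: (b - a)).
Proof.
rewrite /eballv /= => ha hb /andP[s0 s1].
have -> : a + s *: (b - a) - x = (1 - s) *: (a - x) + s *: (b - x).
  apply/rowP => i; rewrite !mxE; ring.
apply: le_trans (enormvD _ _) _; rewrite !enormvZ !ger0_norm ?subr_ge0//.
nra.
Qed.

(** An approximate mean value inequality.  Let [s0] minimise
    [f (a + s *: (b - a)) - s * (f b - f a)] over [0, 1]; this function takes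
    the same value at both ends, so that [s0 < 1] can be arranged.  Decoupling
    the point from its parameter by a quadratic penalty, one minimises
    [f p - s * (f b - f a) + K * enormv (p - a - s *: (b - a)) ^+ 2
      + (s - s0) ^+ 2].
    Optimality in [p] yields a proximal subgradient, and optimality in [s]
    (which may be increased, as [s < 1]) the lower bound on its slope along
    [b - a].  The Lipschitz condition confines the minimiser to a neighbourhood
    of the point of parameter [s0] as [K] grows. *)
Lemma approximate_mean_value f x r r' L a b :
  0 < L -> r' < r -> lipschitz_on_ball f x r L ->
  eballv x r' a -> eballv x r' b ->
  exists2 s0 : R, 0 <= s0 < 1 & forall eta, 0 < eta -> exists p g,
    [/\ enormv (p - (a + s0 *: (b - a))) <= eta, enormv g <= 2 * L,
        f b - f a - eta <= dotv g (b - a) & proximal_subgradient f p g].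
Proof.
move=> L0 rr fL ha hb; pose d := b - a; pose D := f b - f a.
pose q (s : R) := a + s *: d.
have cq : continuous q.
  by move=> s; exact: (cvgD (cvg_cst _) (cvgZr_tmp cvg_id)).
have ip := dotv_inner_product R n.
have qr' s : 0 <= s <= 1 -> eballv x r' (q s) by exact: eballv_segment.
have qr s : 0 <= s <= 1 -> eballv x r (q s).
  by move/qr' => h; apply: le_trans h (ltW rr).
have q0 : q 0 = a by rewrite /q scale0r addr0.
have q1 : q 1 = b by rewrite /q scale1r addrC subrK.
have [s0 /andP[s00 s01] hs0] : exists2 s0, 0 <= s0 < 1 &
    forall s, 0 <= s <= 1 -> f (q s0) - s0 * D <= f (q s) - s * D.
  have [] := @EVT_min R (fun s => f (q s) - s * D) 0 1 ler01.
    apply/subspace_continuousP => s hs /=; apply: cvgB.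
      have := @lipschitz_within f x r L R `[0, 1]%classic q fL cq.
      have h w : `[0, 1]%classic w -> eballv x r (q w).
        by rewrite /= in_itv /=; exact: qr.
      by move/(_ h)/subspace_continuousP; apply.
    by apply: cvg_within_filter; apply: cvgMr_tmp; exact: cvg_id.
  move=> c; rewrite in_itv /= => /andP[c0 c1] hc.
  (* A minimum at [1] is also attained at [0]. *)
  have hc' s : 0 <= s <= 1 -> f (q c) - c * D <= f (q s) - s * D.
    by move=> hs; apply: hc; rewrite in_itv.
  have [c_lt1|] := ltrP c 1; first by exists c => //; rewrite c0.
  move=> c1'; have {}c1 : c = 1 by apply/eqP; rewrite eq_le c1.
  exists 0 => [|s hs]; first by rewrite lexx ltr01.
  apply: le_trans (hc' s hs); rewrite c1 q0 q1 /D; lra.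
exists s0 => [|eta eta0]; first by rewrite s00.
have dn0 := enormv_ge0 d.
have [tau tau0 [tau_s tau_r tau_L tau_eta tau_d]] : exists2 tau : R, 0 < tau &
    [/\ tau < 1 - s0, tau < r - r', tau <= L, 4 * tau <= eta
      & tau * (1 + enormv d) <= eta].
  pose m := Num.min (Num.min (1 - s0) (r - r'))
                    (Num.min L (eta / (4 * (1 + enormv d)))).
  have m0 : 0 < m.
    by rewrite !lt_min L0 divr_gt0 ?mulr_gt0 ?subr_gt0 ?s01 ?rr// ltr_wpDr.
  have : m <= m by [].
  rewrite {2}/m !le_min => /andP[/andP[m1 m2] /andP[m3]].
  rewrite ler_pdivlMr ?mulr_gt0 ?ltr_wpDr// => m4.
  have md : 0 <= m * enormv d by rewrite mulr_ge0// ltW.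
  by exists (m / 2); [|split]; lra.
(* The minimiser satisfies [K * m <= L] and [(s - s0) ^+ 2 <= L * m], where [m]
   is its distance to the segment point of parameter [s]; with this [K] both
   [m] and [`|s - s0|] are at most [tau]. *)
pose K := (L / tau) ^+ 2.
have K0 : 0 < K by rewrite exprn_gt0// divr_gt0.
have Ktau : K * (tau * tau) = L * L.
  by rewrite /K; field; rewrite gt_eqF.
pose Phi (w : 'rV[R]_n * R) :=
  f w.1 - w.2 * D + K * enormv (w.1 - q w.2) ^+ 2 + (w.2 - s0) ^+ 2.
pose B : set ('rV[R]_n * R) := eballv x r `*` `[0, 1]%classic.
have [[p s] pB hmin] : exists2 c, c \in B & forall w, w \in B -> Phi c <= Phi w.
  apply: compact_EVT_min.
  - exists (a, 0); split => /=; last by rewrite in_itv /= lexx ler01.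
    by rewrite -q0; apply: qr; rewrite lexx ler01.
  - by apply: compact_setX; [exact: compact_eballv|exact: segment_compact].
  apply/subspace_continuousP => w Bw /=.
  have c1 : (w.1 @[w --> w] --> w.1) by exact: cvg_fst.
  have c2 : (w.2 @[w --> w] --> w.2) by exact: cvg_snd.
  apply: cvgD; first (apply: cvgD; first apply: cvgB).
  - have := @lipschitz_within f x r L _ B fst fL.
    have h w' : B w' -> eballv x r w'.1 by case.
    have c : continuous (@fst 'rV[R]_n R) by move=> w'; exact: cvg_fst.
    by move/(_ c h)/subspace_continuousP; apply.
  - by apply: cvg_within_filter; apply: cvgMr_tmp.
  - apply: cvg_within_filter; apply: cvgMl_tmp; rewrite expr2.
    have c3 : w.1 - q w.2 @[w --> w] --> w.1 - q w.2.
      exact: (cvgB c1 (cvg_comp _ _ c2 (cq _))).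
    by apply: cvgM; exact: (cvg_enormv _ c3).
  - apply: cvg_within_filter; rewrite expr2.
    have c3 : w.2 - s0 @[w --> w] --> w.2 - s0.
      by apply: cvgB => //; exact: cvg_cst.
    by apply: cvgM.
move: pB; rewrite inE => -[/= px]; rewrite in_itv /= => s_01.
have hmin' p' s' : eballv x r p' -> 0 <= s' <= 1 -> Phi (p, s) <= Phi (p', s').
  by move=> hp hs; apply: hmin; rewrite inE; split => //=; rewrite in_itv.
pose z := p - q s; pose m := enormv z.
have m0 : 0 <= m by exact: enormv_ge0.
(* Compare the minimiser with the point of the segment of parameter [s0]. *)
have est : K * m ^+ 2 + (s - s0) ^+ 2 <= L * m.
  have := hmin' (q s0) s0 (qr _ _) _; rewrite s00 ltW// => /(_ isT isT).
  rewrite /Phi /= subrr enormv0 subrr -/z -/m expr0n /=.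
  have := hs0 s s_01; have := fL _ _ (qr _ s_01) px.
  by rewrite ler_norml enormvB -/z -/m => /andP[_]; lra.
have Km : K * m <= L.
  have [m_gt0|m_le0] := ltrP 0 m; last first.
    have -> : m = 0 by apply/le_anti; rewrite m_le0 m0.
    by rewrite mulr0 ltW.
  rewrite -(ler_pM2r m_gt0) -mulrA -expr2.
  by apply: le_trans est; rewrite lerDl sqr_ge0.
have Lm : L * m <= tau * tau.
  have : K * m * (tau * tau) <= L * (tau * tau).
    by rewrite ler_wpM2r// mulr_ge0// ltW.
  by rewrite mulrAC Ktau -!mulrA ler_pM2l.
have mtau : m <= tau.
  have : L * m <= L * tau by apply: le_trans Lm _; rewrite ler_pM2r.
  by rewrite ler_pM2l.
have stau : `|s - s0| <= tau.
  rewrite -(@ler_pXn2r _ 2) ?nnegrE ?normr_ge0 ?(ltW tau0)//.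
  rewrite real_normK ?num_real//.
  apply: le_trans Lm; apply: le_trans est.
  by rewrite lerDr mulr_ge0 ?sqr_ge0// ltW.
move: (stau); rewrite ler_norml => /andP[stau1 stau2].
exists p, ((- 2 * K) *: z); split.
- have -> : p - (a + s0 *: (b - a)) = z + (s - s0) *: d.
    by apply/rowP => i; rewrite !mxE; ring.
  apply: le_trans (enormvD _ _) _; rewrite enormvZ -/m.
  apply: le_trans tau_d; rewrite mulrDr mulr1 lerD// ler_wpM2r//.
- rewrite enormvZ -/m mulNr normrN gtr0_norm; last exact: mulr_gt0.
  by rewrite -mulrA ler_pM2l.
- rewrite (ipZl ip) -/d -/D.
  have Kd : 0 < K * enormv d ^+ 2 + 1.
    by rewrite ltr_wpDl// mulr_ge0 ?sqr_ge0// ltW.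
  (* Move the parameter from [s] to [s + h] and divide by [h]. *)
  pose h := Num.min (1 - s) (eta / 2 / (K * enormv d ^+ 2 + 1)).
  have h0 : 0 < h by rewrite lt_min; apply/andP; split; [lra|rewrite !divr_gt0].
  have [h1 h2] : h <= 1 - s /\ h * (K * enormv d ^+ 2 + 1) <= eta / 2.
    by split; [|rewrite -ler_pdivlMr//]; rewrite ge_min lexx ?orbT.
  have /andP[s_0 s_1] := s_01.
  have := hmin' p (s + h) px _.
  have -> : 0 <= s + h <= 1 by apply/andP; split; lra.
  move=> /(_ isT); rewrite /Phi /=.
  have -> : p - q (s + h) = z + (- h) *: d.
    by apply/rowP => i; rewrite !mxE; ring.
  rewrite -/z (enormv_sqrD z) enormvZ (ipZr ip) -/m exprMn.
  rewrite real_normK ?num_real// => hle.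
  have : 0 <= h * (- D - 2 * K * dotv z d + 2 * (s - s0)
                   + h * (K * enormv d ^+ 2 + 1)).
    move: hle; rewrite !expr2; lra.
  by rewrite pmulr_rge0//; lra.
- exists K, (r - r' - tau); split => //; first lra.
  move=> y hy; have yx : eballv x r y.
    rewrite /eballv /=; apply: le_trans (enormv_triangle p _ _) _.
    have := enormv_triangle (q s) p x; have := qr' _ s_01.
    rewrite /eballv /= -/z -/m; lra.
  have := hmin' y s yx s_01; rewrite /Phi /=.
  have -> : y - q s = z + (y - p) by apply/rowP => i; rewrite !mxE; ring.
  rewrite -/z (ipZl ip) (enormv_sqrD z); lra.
Qed.

End ProximalSubgradients.
(** * From submonotone subgradients to approximate convexity *)

Section Submonotone.
Variables (R : realType) (n : nat).
Implicit Types (f : 'rV[R]_n -> R) (a b x y p g : 'rV[R]_n) (L r eta : R).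

(** If [f] violates approximate convexity at [z] between [x] and [y], then its
    slope along [y - x] decreases by more than [eps * enormv (x - y)] from the
    segment [x, z] to the segment [z, y].  The mean value inequality on [x, z]
    and on [y, z] turns these slopes into subgradients, taken near a point of
    each segment other than the common endpoint [z].  The first point is thus
    strictly before the second one, and submonotonicity is violated. *)
Lemma submonotone_approximately_convex f xbar L (d eps : R) :
  0 < L -> 0 < d -> 0 < eps -> lipschitz_on_ball f xbar (2 * d) L ->
  (forall p1 p2 g1 g2, eballv xbar (2 * d) p1 -> eballv xbar (2 * d) p2 ->
    proximal_subgradient f p1 g1 -> proximal_subgradient f p2 g2 ->
    enormv g1 <= 2 * L -> enormv g2 <= 2 * L ->
    - (eps / 2) * enormv (p1 - p2) <= dotv (g1 - g2) (p1 - p2)) ->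
  forall x y, eballv xbar d x -> eballv xbar d y -> forall t : R, 0 < t < 1 ->
    f (t *: x + (1 - t) *: y) <=
      t * f x + (1 - t) * f y + eps * t * (1 - t) * enormv (x - y).
Proof.
move=> L0 d0 eps0 fL sub x y hx hy t /andP[t0 t1].
have ip := dotv_inner_product R n.
pose z := t *: x + (1 - t) *: y; rewrite -/z.
pose u := y - x.
have zx : z - x = (1 - t) *: u by apply/rowP => i; rewrite !mxE; ring.
have zy : z - y = (- t) *: u by apply/rowP => i; rewrite !mxE; ring.
have hz : eballv xbar d z.
  have -> : z = x + (1 - t) *: (y - x) by apply/rowP => i; rewrite !mxE; ring.
  by apply: eballv_segment => //; lra.
have dd : d < 2 * d by lra.
have w2 v : eballv xbar d v -> eballv xbar (2 * d) v.
  by move=> hv; apply: le_trans hv (ltW dd).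
rewrite leNgt; apply/negP; rewrite enormvB -/u => viol.
pose gap := f z - (t * f x + (1 - t) * f y + eps * t * (1 - t) * enormv u).
have gap0 : 0 < gap by rewrite subr_gt0.
have u0 : 0 < enormv u.
  rewrite lt_neqAle enormv_ge0 andbT; apply/eqP => un.
  have := fL _ _ (w2 _ hz) (w2 _ hx); have := fL _ _ (w2 _ hz) (w2 _ hy).
  rewrite zx zy !enormvZ -un !mulr0 !normr_le0 !subr_eq0 => /eqP h1 /eqP h2.
  by move: gap0; rewrite /gap -un mulr0 -h1 -h2; lra.
have [s1 /andP[s10 s11] mv1] := approximate_mean_value L0 dd fL hx hz.
have [s2 /andP[s20 s21] mv2] := approximate_mean_value L0 dd fL hy hz.
(* The points of parameters [s1] on [x, z] and [s2] on [y, z] differ by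
   [- k *: u], and [k] is positive because [s1] and [s2] are less than [1]. *)
pose k := 1 - s2 * t - s1 * (1 - t).
have k0 : 0 < k by rewrite /k; nra.
have [eta eta0 [eta_gap eta_d eta_k]] : exists2 eta : R, 0 < eta &
    [/\ eta <= gap, eta <= d & (8 * L + eps) * eta < eps / 2 * (k * enormv u)].
  have L8 : 0 < 8 * L + eps by rewrite addr_gt0// mulr_gt0.
  pose m := Num.min (Num.min gap d) (eps / 2 * (k * enormv u) / (8 * L + eps)).
  have m0 : 0 < m.
    by rewrite !lt_min gap0 d0 /= divr_gt0// !mulr_gt0// invr_gt0.
  have : m <= m by [].
  rewrite {2}/m !le_min (ler_pdivlMr _ _ L8) => /andP[/andP[m1 m2] m3].
  exists (m / 2); first by rewrite divr_gt0.
  have : 0 < m * (8 * L + eps) by rewrite mulr_gt0.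
  by split; lra.
have [p1 [g1 [c1 n1 e1 prox1]]] := mv1 _ eta0.
have [p2 [g2 [c2 n2 e2 prox2]]] := mv2 _ eta0.
rewrite zx (ipZr ip) in e1; rewrite zy (ipZr ip) in e2.
have in_ball a s p : eballv xbar d a -> 0 <= s < 1 ->
    enormv (p - (a + s *: (z - a))) <= eta -> eballv xbar (2 * d) p.
  move=> ha /andP[hs0 hs1] hp; rewrite /eballv /=.
  apply: le_trans (enormv_triangle (a + s *: (z - a)) _ _) _.
  have : eballv xbar d (a + s *: (z - a)).
    by apply: eballv_segment => //; rewrite hs0 ltW.
  rewrite /eballv /=; lra.
have b1 : eballv xbar (2 * d) p1 by apply: in_ball hx _ c1; rewrite s10.
have b2 : eballv xbar (2 * d) p2 by apply: in_ball hy _ c2; rewrite s20.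
have := sub _ _ _ _ b1 b2 prox1 prox2 n1 n2.
pose e := (p1 - (x + s1 *: (z - x))) - (p2 - (y + s2 *: (z - y))).
have ne : enormv e <= 2 * eta.
  by apply: le_trans (enormvD _ _) _; rewrite enormvN; lra.
have p12 : p1 - p2 = e + (- k) *: u.
  by rewrite /e zx zy; apply/rowP => i; rewrite !mxE /k; ring.
(* [t] times the first slope bound plus [1 - t] times the second one. *)
have slope : eps * enormv u <= dotv (g1 - g2) u.
  have tt : 0 < t * (1 - t) by rewrite mulr_gt0// subr_gt0.
  rewrite -(ler_pM2l tt) (ipDl ip) (ipNl ip).
  have h1 : t * (f z - f x - eta) <= t * ((1 - t) * dotv g1 u).
    by rewrite ler_pM2l.
  have h2 : (1 - t) * (f z - f y - eta) <= (1 - t) * (- t * dotv g2 u).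
    by rewrite ler_pM2l// subr_gt0.
  move: eta_gap; rewrite /gap; lra.
have ge : dotv (g1 - g2) e <= 8 * L * eta.
  apply: le_trans (dotv_le _ _) _.
  have : enormv (g1 - g2) <= 4 * L.
    by apply: le_trans (enormvD _ _) _; rewrite enormvN; lra.
  move=> h; have : enormv (g1 - g2) * enormv e <= 4 * L * (2 * eta).
    by apply: ler_pM => //; exact: enormv_ge0.
  lra.
have np : enormv (p1 - p2) <= 2 * eta + k * enormv u.
  rewrite p12; apply: le_trans (enormvD _ _) _.
  by rewrite enormvZ normrN gtr0_norm// lerD2r.
have h1 : eps / 2 * enormv (p1 - p2) <= eps / 2 * (2 * eta + k * enormv u).
  by rewrite ler_pM2l// divr_gt0.
have h2 : k * (eps * enormv u) <= k * dotv (g1 - g2) u by rewrite ler_pM2l.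
rewrite {2}p12 (ipDr ip) (ipZr ip).
lra.
Qed.

End Submonotone.

(** * Subsmoothness and subgradients of a representation *)

Section Subsmooth.
Variables (R : realType) (n : nat).
Local Notation V := ('rV[R]_n * R^o)%type.
Implicit Types (Omega : set V) (v omega nu : V) (f : 'rV[R]_n -> R).

(** The quadratic error of the proximal inequality is negligible with respect to
    the distance, and moving upwards from the graph only helps since the last
    coordinate of the normal is negative. *)
Lemma proximal_frechet Omega omega (A : {linear V -> V}) f (r : R) v nu p g :
  Defs.isometry A ->
  (forall v, eball omega r v -> Omega v <-> epi f (A v)) ->
  enorm (v - omega) < r -> A v = (p, f p) -> A nu = (g, - 1) ->
  proximal_subgradient f p g -> frechet_normal_cone Omega v nu.
Proof.
move=> hA hr vr Av Anu [K [rho [K0 rho0 prox]]] eps eps0.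
pose d := Num.min rho (Num.min (eps / K) (r - enorm (v - omega))).
have d0 : 0 < d by rewrite !lt_min rho0 divr_gt0// subr_gt0.
exists d => // z [Oz]; rewrite /eball /= !le_min (ler_pdivlMr _ _ K0).
move=> /andP[z1 /andP[z2 z3]].
have : epi f (A z).
  apply/hr => //; rewrite /eball /=.
  by apply: le_trans (enorm_triangle v _ _) _; lra.
rewrite /epi /= => Ez; rewrite -(isometry_dot hA) linearB Anu Av.
have np : enormv ((A z).1 - p) <= enorm (z - v).
  by rewrite -hA linearB Av; exact: enormv_le_enorm (A z - (p, f p)).
rewrite /dot /=.
have := prox _ (le_trans np z1).
have np0 := enormv_ge0 ((A z).1 - p).
have : K * enormv ((A z).1 - p) ^+ 2 <= eps * enorm (z - v).
  apply: le_trans (_ : K * (enorm (z - v)) ^+ 2 <= _).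
    by rewrite ler_pM2l// lerXn2r ?nnegrE ?enorm_ge0.
  by rewrite expr2 mulrA ler_wpM2r ?enorm_ge0// mulrC.
lra.
Qed.

(** A Lipschitz constant may always be enlarged, and a positive one allows
    division by it. *)
Lemma lipschitz_near_pos f x : lipschitz_near f x ->
  exists L r : R, [/\ 0 < L, 0 < r & lipschitz_on_ball f x r L].
Proof.
case=> L [r [r0 fL]]; exists (Num.max L 1), r; split => //.
  by rewrite lt_max ltr01 orbT.
move=> y z hy hz; apply: le_trans (fL _ _ hy hz) _.
by rewrite ler_wpM2r ?enormv_ge0// le_max lexx.
Qed.

(** A point strictly above the graph is interior, by continuity of [f]. *)
Lemma boundary_on_graph Omega omega (A : {linear V -> V}) f :
  closed Omega -> (closure Omega `\` interior Omega) omega ->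
  lipschitz_representation Omega omega A f -> f (A omega).1 = (A omega).2.
Proof.
move=> cO [clO nint] rep; have [r r0 hr] := representation_near rep.
have [hA /lipschitz_near_pos[L [r1 [L0 r10 fL]]] _] := rep.
have Oo : Omega omega by rewrite (proj1 (closure_id _) cO).
have b0 : eball omega r omega by rewrite /eball /= subrr enorm0 ltW.
have : f (A omega).1 <= (A omega).2 by apply/hr.
rewrite le_eqVlt => /orP[/eqP//|gap]; exfalso; apply: nint.
pose gam := (A omega).2 - f (A omega).1.
have L1 : 0 < 1 + L by rewrite addr_gt0.
pose d := Num.min r (Num.min r1 (gam / (1 + L))).
have d0 : 0 < d by rewrite !lt_min r0 r10 divr_gt0// subr_gt0.
apply: filterS (nbhs_eball omega d0) => v.
rewrite /eball /= !le_min (ler_pdivlMr _ _ L1) => /andP[v1 /andP[v2 v3]].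
apply/hr => //; rewrite /epi /=.
have n1 : enormv ((A v).1 - (A omega).1) <= enorm (v - omega).
  by rewrite -hA linearB; exact: enormv_le_enorm (A v - A omega).
have n2 : `|(A v).2 - (A omega).2| <= enorm (v - omega).
  by rewrite -hA linearB; exact: norm_le_enorm (A v - A omega).
have := fL _ _ (le_trans n1 v2) (_ : eballv (A omega).1 r1 (A omega).1).
rewrite /eballv /= subrr enormv0 (ltW r10) => /(_ isT).
have : L * enormv ((A v).1 - (A omega).1) <= L * enorm (v - omega).
  by rewrite ler_pM2l.
move: n2; rewrite !ler_norml => /andP[n2 n3] h1 /andP[h2 h3].
move: v3; rewrite /gam; lra.
Qed.

(** Subsmoothness, restricted to the normals [(g, -1)] that come from proximal
    subgradients [g], says that these subgradients are submonotone up to an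
    arbitrarily small multiple of the distance. *)
Lemma subsmooth_approximately_convex Omega omega (A : {linear V -> V}) f :
  subsmooth Omega omega -> lipschitz_representation Omega omega A f ->
  f (A omega).1 = (A omega).2 -> approximately_convex f (A omega).1.
Proof.
move=> [cO Oo hsub] rep fgraph; have [r r0 hr] := representation_near rep.
have [hA /lipschitz_near_pos[L [r1 [L0 r10 fL]]] _] := rep.
move=> eps eps0; have L1 : 0 < 1 + L by rewrite addr_gt0.
have [||d0 d00 hd] := hsub (2 * L + 1) (eps / (2 * (1 + L))).
- by rewrite addr_gt0// mulr_gt0.
- by rewrite divr_gt0// mulr_gt0.
pose m := Num.min r1 (Num.min d0 r / (1 + L)).
have m0 : 0 < m by rewrite lt_min r10 divr_gt0// lt_min d00.
have : m <= m by [].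
rewrite {2}/m le_min (ler_pdivlMr _ _ L1) le_min => /andP[m1 /andP[m2 m3]].
exists (m / 3); first by rewrite divr_gt0.
have fL' : lipschitz_on_ball f (A omega).1 (2 * (m / 3)) L.
  move=> y z hy hz.
  by apply: fL; [apply: le_trans hy _|apply: le_trans hz _]; lra.
apply: (submonotone_approximately_convex L0 _ eps0 fL').
  by rewrite divr_gt0.
have graph_dist p p' : eballv (A omega).1 (2 * (m / 3)) p ->
    eballv (A omega).1 (2 * (m / 3)) p' ->
    enorm ((p, f p) - (p', f p') : V) <= (1 + L) * enormv (p - p').
  move=> hp hp'; apply: le_trans (enorm_le_add _) _ => /=.
  by have := fL' _ _ hp hp'; lra.
have center : eballv (A omega).1 (2 * (m / 3)) (A omega).1.
  by rewrite /eballv /= subrr enormv0; lra.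
have normal p g : eballv (A omega).1 (2 * (m / 3)) p ->
    proximal_subgradient f p g -> enormv g <= 2 * L ->
    exists v nu, [/\ A v = (p, f p), A nu = (g, - 1),
                     (eball omega d0 `&` Omega) v
                   & truncated_clarke_normal_cone (2 * L + 1) Omega v nu].
  move=> hp prox ng; have [v Av] := isometry_surj hA (p, f p).
  have [nu Anu] := isometry_surj hA (g, - 1).
  have vd : enorm (v - omega) <= (1 + L) * (2 * (m / 3)).
    rewrite -hA linearB Av [A omega]surjective_pairing -fgraph.
    apply: le_trans (graph_dist _ _ hp center) _.
    by rewrite ler_pM2l.
  have mL : 0 < m * (1 + L) by rewrite mulr_gt0.
  have vr : enorm (v - omega) < r by lra.
  have Ov : Omega v by apply/hr; [exact: ltW|rewrite Av /epi /=].
  exists v, nu; split => //; first by split => //; rewrite /eball /=; lra.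
  split.
    apply: frechet_sub_clarke => //.
    exact: proximal_frechet hr vr Av Anu prox.
  rewrite /eball /= subr0 -hA Anu; apply: le_trans (enorm_le_add _) _.
  by rewrite /= normrN1 lerD2r.
move=> p1 p2 g1 g2 b1 b2 prox1 prox2 n1 n2.
have [v1 [nu1 [Av1 Anu1 O1 N1]]] := normal _ _ b1 prox1 n1.
have [v2 [nu2 [Av2 Anu2 O2 N2]]] := normal _ _ b2 prox2 n2.
have := hd _ _ _ _ O1 O2 N1 N2.
rewrite -(isometry_dot hA) -(hA (v1 - v2)) !linearB Av1 Av2 Anu1 Anu2.
rewrite {1}/dot /= subrr mul0r addr0; apply: le_trans.
rewrite !mulNr lerN2 invfM mulrA -[leLHS]mulrA.
rewrite ler_pM2l ?divr_gt0// -(ler_pM2l L1) mulrA divff ?gt_eqF// mul1r.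
exact: graph_dist.
Qed.

End Subsmooth.

Theorem proposition4p4 (R : realType) (n : nat)
    (Omega : set ('rV[R]_n * R^o)%type) (omegabar : ('rV[R]_n * R^o)%type)
    (hclosed : closed Omega) (hepi : epi_lipschitz Omega)
    (hbdry : (closure Omega `\` interior Omega) omegabar) :
  [<-> clarke_super_regular Omega omegabar;
       subsmooth Omega omegabar;
       forall (A : {linear ('rV[R]_n * R^o)%type -> ('rV[R]_n * R^o)%type})
              (f : 'rV[R]_n -> R),
         lipschitz_representation Omega omegabar A f ->
         approximately_convex f (A omegabar).1;
       exists (A : {linear ('rV[R]_n * R^o)%type -> ('rV[R]_n * R^o)%type})
              (f : 'rV[R]_n -> R),
         lipschitz_representation Omega omegabar A f /\
         approximately_convex f (A omegabar).1].
Proof.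
have Oo : Omega omegabar by rewrite (proj1 (closure_id _) hclosed); case: hbdry.
tfae.
- exact: super_regular_subsmooth.
- move=> hsub A f rep; apply: (subsmooth_approximately_convex hsub rep).
  exact: boundary_on_graph hclosed hbdry rep.
- move=> hall; have [A [f hrep]] := hepi _ Oo.
  by exists A, f; split => //; exact: hall.
- move=> [A [f [rep hf]]].
  exact: approximately_convex_super_regular hclosed Oo rep hf.
Qed.
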